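(* Let $$\Gamma=\{313, 320, 323, 324, 326, 329, 331, 332, 333, 334\}\cup\{337,338,\ldots,341\}\cup\{343,344,\ldots,468\}\cup\{470,471,\ldots,480\}\cup\{482,483,\ldots,486\}\cup\{488,489,\ldots,494\}\cup\{496,497,\ldots,500\}\cup\{503, 504, 506, 512, 516, 518, 522, 524, 528, 536, 554, 560\},$$ where dots denote all consecutive integers in the indicated range. For every $\beta\in\Gamma$ there exists a ternary near-extremal self-dual code of length $48$ with $A_{12}=8\beta$, where $A_{12}$ is the number of codewords of weight $12$.
   Context: A ternary code of length $n$ is a linear subspace $C$ of $GF(3)^n$. It is self-dual if $C=C^\perp$ with respect to the standard inner product $\sum_i x_i y_i$ over $GF(3)$. The weight of a vector is the number of its nonzero coordinates, and the minimum weight of $C$ is the smallest weight of a nonzero codeword. A self-dual ternary code of length $n$ divisible by $12$ is called near-extremal if its minimum weight is exactly $n/4$; thus a near-extremal self-dual ternary code of length $48$ is one of minimum weight $12$ (and dimension $24$). *)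

(* Defs.v *)
From HB Require Import structures.
From mathcomp Require Import all_boot all_order all_algebra.

Set Implicit Arguments.
Unset Strict Implicit.
Unset Printing Implicit Defensive.

Import GRing.Theory.

Notation ternary_code n := {vspace 'rV['F_3]_n}.

Definition inner n (x y : 'rV['F_3]_n) : 'F_3 :=
  (\sum_(i < n) x ord0 i * y ord0 i)%R.

Definition dual_code n (C : ternary_code n) : {set 'rV['F_3]_n} :=
  [set x | [forall (y | y \in C), inner x y == 0%R]].

Definition self_dual n (C : ternary_code n) : Prop := C =i dual_code C.

Definition weight n (x : 'rV['F_3]_n) : nat := #|[set i | x ord0 i != 0%R]|.

(* Relational, so that the zero code, which has no nonzero codeword, has no
   minimum weight. *)
Definition is_min_weight n (C : ternary_code n) (d : nat) : Prop :=
  (exists x, [/\ x \in C, x != 0%R & weight x = d]) /\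
  (forall x, x \in C -> x != 0%R -> d <= weight x).

Definition near_extremal_self_dual n (C : ternary_code n) : Prop :=
  [/\ 12 %| n, self_dual C & is_min_weight C (n %/ 4)].

Definition num_weight n (C : ternary_code n) (w : nat) : nat :=
  #|[set x | (x \in C) && (weight x == w)]|.

Definition Gamma : {pred nat} := [pred b : nat |
  [|| b \in [:: 313; 320; 323; 324; 326; 329; 331; 332; 333; 334],
      337 <= b <= 341,
      343 <= b <= 468,
      470 <= b <= 480,
      482 <= b <= 486,
      488 <= b <= 494,
      496 <= b <= 500
    | b \in [:: 503; 504; 506; 512; 516; 518; 522; 524; 528; 536; 554; 560]]].

(* Main.v *)
From Stdlib Require Import BinNat.
Require Import Defs.
From mathcomp Require Import all_boot all_order all_algebra.
From mathcomp Require Import zify ring.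

(** Let [X] and [Y] be self-dual ternary codes of length 24. The words
    [(a + b | a - b)] with [a] in [X] and [b] in [Y] form a self-dual code of
    length 48: inner products double to [2 <a, a'> + 2 <b, b'> = 0], and the
    dimensions add up to 24. On a coordinate where both [a] and [b] are nonzero
    exactly one of [a + b] and [a - b] vanishes, so that
      [wt (a + b | a - b) = 2 |a| + 2 |b| - 3 I],
    where [I] counts the coordinates in both supports ([weight_glue]). Hence the
    weight depends on the two supports only, and as [I] is at most [|a|] and at
    most [|b|], the weight is at least both [|a|] and [|b|]. Only words of weight
    at most 12 in [X] and [Y] matter.

    Take [Y] of minimum weight 9 and [X] of minimum weight at least 6. Weights
    in the two codes are multiples of 3, which leaves few ways to reach a small
    total. Weight 12 comes from [b = 0], [|a| = 6], or from
      [(|a|, |b|, I) = (6, 9, 6), (9, 9, 8), (12, 12, 12)],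
    and a nonzero weight below 12 only from [(9, 9, 9)]. So the code is
    near-extremal exactly when no support of size 9 is shared, and then
      [A_12 = 2 (n_6 + 2 N)],
    where [N] counts the pairs of supports of the three kinds and [n_6] the
    supports of size 6, each support being counted once for every pair of
    opposite words ([card_weight12]).

    The numbers [I] change when the coordinates of [Y] are permuted. One
    fixed [Y] and nine choices of [X] suffice: each beta in Gamma arises
    from a permutation of the last eight coordinates of [Y].

    What remains is a count of pairs among tens of thousands of supports, for
    181 permutations. It is organised around two observations.
    - If [|s| = j + k], [|t| = j + l] and [I <= j], then [I = j] exactly when one
      set is obtained both by removing [k] points from [s] and by removing [l]
      points from [t]; such a set is then unique ([coincidencesE]). Counting
      pairs thus becomes counting equal entries in two lists of smaller sets.
    - The permutations fix the first sixteen coordinates. For all [u] and [v] in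
      [{0,1}^8], tabulate once the number of pairs of smaller sets that agree on
      the first sixteen coordinates and end in [u] and in [v]. The count for any
      permutation is the sum of the 256 entries in which it carries [v] to
      [u] ([matches_cross]).

    The smaller sets and the table are kept in binary trees indexed by boolean
    lists, and the whole verification is evaluated in [codes_checked]. *)

Set Implicit Arguments.
Unset Strict Implicit.
Unset Printing Implicit Defensive.

Import GRing.Theory.

Notation F3 := 'F_3.

(** * Vectors over the field with three elements *)

Local Open Scope ring_scope.

Lemma F3P (a : F3) : [\/ a = 0, a = 1 | a = -1].
Proof.
case: a => [[|[|[|m]]] Hm] //; [apply: Or31|apply: Or32|apply: Or33]; exact: val_inj.
Qed.

Fixpoint vecs (n : nat) : seq (seq F3) :=
  if n is m.+1 then
    [seq 0 :: c | c <- vecs m] ++ [seq 1 :: c | c <- vecs m]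
      ++ [seq -1 :: c | c <- vecs m]
  else [:: [::]].

Lemma mem_map_cons (T : eqType) (a b : T) c s :
  (a :: c \in [seq b :: x | x <- s]) = (a == b) && (c \in s).
Proof.
apply/mapP/andP => [[x xs [-> ->]]|[/eqP-> cs]]; last by exists c.
by rewrite eqxx.
Qed.

Lemma mem_vecs n c : (c \in vecs n) = (size c == n).
Proof.
elim: n c => [|n IH] [|a c] //=.
  by rewrite !mem_cat; apply/negbTE; rewrite !negb_or; apply/and3P;
     split; apply/mapP => -[].
rewrite !mem_cat !mem_map_cons IH -!andb_orl eqSS.
by case: (F3P a) => ->.
Qed.

Lemma vecs_uniq n : uniq (vecs n).
Proof.
have inj b : injective (cons b : seq F3 -> _) by move=> x y [].
elim: n => //= n IH; rewrite !cat_uniq !map_inj_uniq // IH /= andbT.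
apply/andP; split; [rewrite has_cat negb_or; apply/andP; split|];
by apply/hasPn => _ /mapP[x _ ->]; apply/mapP => -[].
Qed.

Arguments vecs n : simpl never.

Definition rowseq n (x : 'rV[F3]_n) : seq F3 := [seq x ord0 i | i <- enum 'I_n].

Definition seqrow n (s : seq F3) : 'rV[F3]_n := \row_j s`_j.

Lemma size_rowseq n (x : 'rV[F3]_n) : size (rowseq x) = n.
Proof. by rewrite size_map size_enum_ord. Qed.

Lemma nth_rowseq n (x : 'rV[F3]_n) (i : 'I_n) : (rowseq x)`_i = x ord0 i.
Proof. by rewrite (nth_map i) ?size_enum_ord // nth_ord_enum. Qed.

Lemma rowseqK n : cancel (@rowseq n) (@seqrow n).
Proof. by move=> x; apply/rowP => i; rewrite mxE nth_rowseq. Qed.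

Lemma seqrowK n s : size s = n -> rowseq (seqrow n s) = s.
Proof.
move=> sz; apply: (@eq_from_nth _ 0); rewrite size_rowseq // => i lt_in.
by rewrite (nth_rowseq _ (Ordinal lt_in)) mxE.
Qed.

Lemma sum_rowseq n (f : seq F3 -> nat) :
  (\sum_(x : 'rV[F3]_n) f (rowseq x) = \sum_(c <- vecs n) f c)%N.
Proof.
rewrite -(big_map (@rowseq n) xpredT f); apply: perm_big; apply: uniq_perm.
- by rewrite map_inj_uniq ?index_enum_uniq //; exact: can_inj (@rowseqK n).
- exact: vecs_uniq.
move=> c; rewrite mem_vecs; apply/mapP/eqP => [[x _ ->]|sz]; first exact: size_rowseq.
by exists (seqrow n c); rewrite ?mem_index_enum ?seqrowK.
Qed.

Lemma sum_row_mx m n (f : 'rV[F3]_m -> 'rV[F3]_n -> nat) :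
  (\sum_(u : 'rV[F3]_(m + n)) f (lsubmx u) (rsubmx u) = \sum_x \sum_y f x y)%N.
Proof.
rewrite pair_big (reindex (fun e : 'rV_m * 'rV_n => row_mx e.1 e.2)) /=.
  by apply: eq_bigr => -[x y] _; rewrite row_mxKl row_mxKr.
exists (fun u => (lsubmx u, rsubmx u)) => [[x y]|u] _ /=; rewrite ?hsubmxK //.
by rewrite row_mxKl row_mxKr.
Qed.

Local Close Scope ring_scope.

(** * Supports of the light words of a code *)

(** The field elements again, as constants on which evaluation is cheap; [den]
    is the meaning of a constant. *)
Inductive trit : Type := T0 | T1 | T2.

Definition den (a : trit) : F3 := match a with T0 => 0 | T1 => 1 | T2 => -1 end%R.

Definition nonzero (a : trit) : bool := if a is T0 then false else true.

Definition topp (a : trit) : trit :=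
  match a with T0 => T0 | T1 => T2 | T2 => T1 end.

Definition tadd (a b : trit) : trit :=
  match a, b with
  | T0, x | x, T0 => x
  | T1, T1 => T2
  | T2, T2 => T1
  | _, _ => T0
  end.

Definition tmul (a b : trit) : trit :=
  match a, b with
  | T0, _ | _, T0 => T0
  | T1, x | x, T1 => x
  | T2, T2 => T1
  end.

Fixpoint vadd (u v : seq trit) : seq trit :=
  if u is a :: u' then if v is b :: v' then tadd a b :: vadd u' v' else [::]
  else [::].

Fixpoint light (b : nat) (v : seq trit) : bool :=
  match v with
  | [::] => true
  | T0 :: w => light b w
  | _ :: w => if b is b'.+1 then light b' w else false
  end.

(** The weight test on [u + v] without building [u + v]: almost all sums
    fail it, so the sum itself is rarely needed. *)
Fixpoint light_sum (b : nat) (u v : seq trit) : bool :=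
  match u, v with
  | T0 :: u', T0 :: v' | T1 :: u', T2 :: v' | T2 :: u', T1 :: v' =>
      light_sum b u' v'
  | _ :: u', _ :: v' => if b is b'.+1 then light_sum b' u' v' else false
  | _, _ => true
  end.

Definition keep (v : seq trit) (acc : seq (seq bool)) : seq (seq bool) :=
  if light 12 v then map nonzero v :: acc else acc.

Definition keep_sum (u v : seq trit) (acc : seq (seq bool)) : seq (seq bool) :=
  if light_sum 12 u v then map nonzero (vadd u v) :: acc else acc.

(** The lists grow from the right, with [acc] as tail. Treating the last row apart
    means that two thirds of the words are tested before they are built. *)
Fixpoint spread (rows : seq (seq trit)) (v : seq trit) (acc : seq (seq bool)) :=
  match rows with
  | [::] => keep v acc
  | [:: r] => keep v (keep_sum v r (keep_sum v (map topp r) acc))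
  | r :: rs =>
      spread rs v (spread rs (vadd v r) (spread rs (vadd v (map topp r)) acc))
  end.

(** One word out of each pair of opposite nonzero words: the one whose first
    nonzero coefficient is 1. *)
Fixpoint supports (rows : seq (seq trit)) : seq (seq bool) :=
  if rows is r :: rs then spread rs r (supports rs) else [::].

Lemma denD a b : den (tadd a b) = (den a + den b)%R.
Proof. by case: a b => [] []; apply: val_inj. Qed.

Lemma denM a b : den (tmul a b) = (den a * den b)%R.
Proof. by case: a b => [] []; apply: val_inj. Qed.

Lemma denN a : den (topp a) = (- den a)%R.
Proof. by case: a; apply: val_inj. Qed.

Lemma nonzeroE a : nonzero a = (den a != 0%R).
Proof. by case: a. Qed.

Lemma size_vadd u v : size u = size v -> size (vadd u v) = size u.
Proof. by elim: u v => [|a u IH] [|b v] //= [/IH->]. Qed.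

Lemma nth_vadd u v i : size u = size v ->
  nth T0 (vadd u v) i = tadd (nth T0 u i) (nth T0 v i).
Proof. by elim: u v i => [|a u IH] [|b v] [|i] //= [/IH->]. Qed.

Lemma nth_topp r i : nth T0 (map topp r) i = topp (nth T0 r i).
Proof. by elim: r i => [|a r IH] [|i] //=. Qed.

Lemma lightE b v : light b v = (count nonzero v <= b).
Proof.
elim: v b => [|a v IH] b //=.
by case: a => /=; rewrite ?IH ?add0n //; case: b => // b; rewrite IH add1n.
Qed.

Lemma light_sumE b u v : size u = size v -> light_sum b u v = light b (vadd u v).
Proof.
elim: u v b => [|a u IH] [|c v] b // [sz]; rewrite [vadd _ _]/=.
by case: a; case: c => /=; rewrite ?IH //; case: b => // b; rewrite IH.
Qed.

Lemma spread_cons r rs v acc : size r = size v ->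
  spread (r :: rs) v acc
  = spread rs v (spread rs (vadd v r) (spread rs (vadd v (map topp r)) acc)).
Proof.
case: rs => // sz; rewrite /= /keep /keep_sum !light_sumE ?size_map //.
Qed.

Section Words.
Variable n : nat.

Definition val_at (c : seq F3) (rows : seq (seq trit)) (i : nat) : F3 :=
  (\sum_(e <- zip c rows) e.1 * den (nth T0 e.2 i))%R.

Definition sup (g : nat -> F3) : seq bool := [seq g i != 0%R | i <- iota 0 n].

(** The enumeration only lists words of weight at most 12, so sums over it see
    [f] through this restriction. *)
Definition cut (f : seq bool -> nat) (s : seq bool) : nat :=
  if count id s <= 12 then f s else 0.

Lemma eq_sup g h : g =1 h -> sup g = sup h.
Proof. by move=> e; apply: eq_map => i; rewrite e. Qed.

Lemma map_nonzero v : size v = n -> map nonzero v = sup (fun i => den (nth T0 v i)).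
Proof.
move=> sz; rewrite -{1}(mkseq_nth T0 v) /mkseq sz -map_comp.
by apply: eq_map => i /=; rewrite nonzeroE.
Qed.

Lemma val_at_cons a c r rows i :
  val_at (a :: c) (r :: rows) i = (a * den (nth T0 r i) + val_at c rows i)%R.
Proof. by rewrite /val_at /= big_cons. Qed.

Lemma sum_vecsS m (h : seq F3 -> nat) :
  \sum_(c <- vecs m.+1) h c = \sum_(c <- vecs m) h (0%R :: c)
    + (\sum_(c <- vecs m) h (1%R :: c) + \sum_(c <- vecs m) h ((-1)%R :: c)).
Proof. by rewrite [vecs _]/= !big_cat !big_map. Qed.

(** Each step of [spread] splits the combinations according to the coefficient
    of the first row, so the list is a rearrangement of the light combinations. *)
Lemma sum_spread f rows v acc : size v = n -> all (fun r => size r == n) rows ->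
  \sum_(s <- spread rows v acc) f s
  = \sum_(c <- vecs (size rows)) cut f (sup (fun i => (den (nth T0 v i) + val_at c rows i)%R))
    + \sum_(s <- acc) f s.
Proof.
elim: rows v acc => [|r rs IH] v acc szv.
  rewrite [vecs _]/= big_seq1 /= /keep lightE /cut => _.
  have -> : sup (fun i => (den (nth T0 v i) + val_at [::] [::] i)%R) = map nonzero v.
    by rewrite map_nonzero //; apply: eq_sup => i; rewrite /val_at big_nil addr0.
  by rewrite count_map; case: ifP; rewrite ?big_cons.
case/andP=> /eqP szr szrs; rewrite spread_cons ?szr //.
rewrite !IH ?size_vadd ?size_map ?szr ?szv // [size _]/= sum_vecsS -!addnA.
congr (_ + (_ + (_ + _))); apply: eq_bigr => c _; congr cut; apply: eq_sup => i.
- by rewrite val_at_cons mul0r add0r.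
- by rewrite nth_vadd ?szr ?szv // denD val_at_cons mul1r addrA.
rewrite nth_vadd ?size_map ?szr ?szv // denD val_at_cons mulN1r addrA.
by rewrite nth_topp denN.
Qed.

Lemma neg_vecs m : perm_eq [seq [seq (- a)%R | a <- c] | c <- vecs m] (vecs m).
Proof.
have negK : involutive (fun c : seq F3 => [seq (- a)%R | a <- c]).
  by move=> c; rewrite -map_comp -[RHS]map_id; apply: eq_map => a /=; exact: opprK.
apply: uniq_perm; rewrite ?vecs_uniq ?(map_inj_uniq (inv_inj negK)) ?vecs_uniq // => c.
by rewrite -{1}(negK c) (mem_map (inv_inj negK)) !mem_vecs size_map.
Qed.

Lemma val_at_neg c rows i : val_at [seq (- a)%R | a <- c] rows i = (- val_at c rows i)%R.
Proof.
elim: c rows => [|a c IH] [|r rows]; try by rewrite /val_at /= big_nil oppr0.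
by rewrite [map _ _]/= !val_at_cons IH opprD mulNr.
Qed.

(** Opposite words have equal supports. The leading coefficient of a nonzero
    combination is 1 or -1, and the two halves contribute equally; what is left
    is the zero combination. *)
Lemma sum_supports f rows : all (fun r => size r == n) rows ->
  \sum_(c <- vecs (size rows)) cut f (sup (val_at c rows))
  = f (nseq n false) + 2 * \sum_(s <- supports rows) f s.
Proof.
elim: rows => [_|r rs IH] /=.
  rewrite big_seq1 big_nil muln0 addn0.
  have -> : sup (val_at [::] [::]) = nseq n false.
    apply: (@eq_from_nth _ false); rewrite ?size_map ?size_iota ?size_nseq // => i lt_i.
    by rewrite (nth_map 0) ?size_iota // /val_at big_nil eqxx nth_nseq if_same.
  by rewrite /cut count_nseq mul0n.
case/andP=> /eqP szr szrs; rewrite sum_spread // sum_vecsS.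
have opp : \sum_(c <- vecs (size rs)) cut f (sup (val_at ((-1)%R :: c) (r :: rs)))
         = \sum_(c <- vecs (size rs)) cut f (sup (val_at (1%R :: c) (r :: rs))).
  rewrite -(perm_big _ (neg_vecs (size rs))) big_map; apply: eq_bigr => c _.
  congr cut; apply: eq_map => i.
  by rewrite !val_at_cons val_at_neg mulN1r mul1r -opprD oppr_eq0.
rewrite opp mulnDr [RHS]addnCA -IH // mul2n -addnn [RHS]addnC; congr (_ + (_ + _)).
- by apply: eq_bigr => c _; congr cut; apply: eq_sup => i; rewrite val_at_cons mul0r add0r.
- by apply: eq_bigr => c _; congr cut; apply: eq_sup => i; rewrite val_at_cons mul1r.
by apply: eq_bigr => c _; congr cut; apply: eq_sup => i; rewrite val_at_cons mul1r.
Qed.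

End Words.

(** * Sizes of intersections *)

(** Sets are characteristic sequences: a removed point turns from true to false. *)
Fixpoint drops (k : nat) (s : seq bool) {struct s} : seq (seq bool) :=
  match k, s with
  | 0, _ => [:: s]
  | _.+1, [::] => [::]
  | k'.+1, b :: s' =>
      let kept := [seq b :: z | z <- drops k s'] in
      if b then [seq false :: z | z <- drops k' s'] ++ kept else kept
  end.

Definition below (z s : seq bool) : bool := all (fun e => e.1 ==> e.2) (zip z s).

Definition common (s t : seq bool) : nat := count (fun e => e.1 && e.2) (zip s t).

Lemma drops0 s : drops 0 s = [:: s]. Proof. by case: s. Qed.

Lemma sum_drops_cons k b s (h : seq bool -> nat) :
  \sum_(z <- drops k (b :: s)) h z
  = (if b then if k is k'.+1 then \sum_(z <- drops k' s) h (false :: z) else 0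
     else 0) + \sum_(z <- drops k s) h (b :: z).
Proof.
case: k => [|k]; first by rewrite !drops0 !big_seq1; case: b.
by rewrite /=; case: b; rewrite ?big_cat !big_map.
Qed.

Lemma below_count z s : size z = size s -> below z s -> count id z <= count id s.
Proof.
elim: z s => [|a z IH] [|b s] //= [sz] /andP[ab /(IH _ sz)]; rewrite -/(below _ _).
by case: a b ab => [] [] //=; lia.
Qed.

Lemma below_eq z s : size z = size s -> below z s -> count id s <= count id z -> z = s.
Proof.
elim: z s => [|a z IH] [|b s] //= [sz] /andP[ab zs] le.
have le' := below_count sz zs.
rewrite (IH s) //; last by case: a b ab le => [] [] //=; lia.
by congr (_ :: _); case: a b ab le => [] [] //=; lia.
Qed.

Lemma below_refl s : below s s.
Proof. by elim: s => // b s IH; rewrite /below /= implybb; exact: IH. Qed.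

(** For [k = 0] the recursion stops without reading [s]; the other side then
    leaves only [s] by [below_eq]. *)
Lemma mem_drops k s z :
  (z \in drops k s) = [&& size z == size s, below z s & count id z + k == count id s].
Proof.
elim: s k z => [|b s IH] [|k] z.
- by rewrite drops0 inE; case: z.
- by rewrite in_nil addnS /= !andbF.
- rewrite drops0 inE addn0; apply/eqP/and3P => [->|[/eqP sz zs /eqP cnt]].
    by rewrite !eqxx below_refl.
  by apply: below_eq; rewrite ?cnt.
case: z => [|a z].
  by rewrite [RHS]/=; case: b => /=; rewrite ?mem_cat; apply/negbTE; rewrite ?negb_or;
     do ?[apply/andP; split]; apply/mapP => -[].
rewrite [drops _ _]/=; case: b; rewrite ?mem_cat !(@mem_map_cons bool) !IH /= eqSS -/(below _ _);
  case: a => /=; rewrite ?andbF ?orbF ?addSn ?add0n ?addnS ?eqSS //.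
Qed.

Lemma uniq_drops k s : uniq (drops k s).
Proof.
have inj b : injective (cons b : seq bool -> _) by move=> x y [].
elim: s k => [|b s IH] [|k] //=.
case: b; rewrite ?cat_uniq !map_inj_uniq // !IH //= andbT.
by apply/hasPn => _ /mapP[z _ ->]; apply/mapP => -[].
Qed.

Lemma size_in_drops k s z : z \in drops k s -> size z = size s.
Proof. by rewrite mem_drops => /and3P[/eqP]. Qed.

Lemma common_le s t : common s t <= count id s.
Proof.
rewrite /common; elim: s t => [|b s IH] [|c t] //=.
by have := IH t; case: b; case: c => /=; lia.
Qed.

Lemma commonC s t : common s t = common t s.
Proof. by elim: s t => [|b s IH] [|c t] //=; rewrite /common /= -!/(common _ _) IH andbC. Qed.

Definition meet (s t : seq bool) : seq bool := [seq e.1 && e.2 | e <- zip s t].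

Lemma meetP s t : size s = size t ->
  [/\ size (meet s t) = size s, below (meet s t) s, below (meet s t) t
    & count id (meet s t) = common s t].
Proof.
move=> sz; split.
- by rewrite size_map size_zip sz minnn.
- elim: s t sz => [|b s IH] [|c t] //= [/IH]; rewrite /below /= => ->.
  by case: b; case: c.
- elim: s t sz => [|b s IH] [|c t] //= [/IH]; rewrite /below /= => ->.
  by case: b; case: c.
by rewrite count_map.
Qed.

Lemma below_meet z s t : size z = size s -> size z = size t ->
  below z s -> below z t -> below z (meet s t).
Proof.
elim: z s t => [|a z IH] [|b s] [|c t] // [ss] [st] /andP[ab zs] /andP[ac zt].
by apply/andP; split; [case: a ab ac => //= -> -> | exact: IH].
Qed.

Definition coincidences (k l : nat) (s t : seq bool) : nat :=
  \sum_(z <- drops l t) count (pred1 z) (drops k s).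

(** A common subset with [j] points lies in the intersection, which has at most
    [j] points; so it is the intersection, and it exists exactly when the
    intersection has [j] points. *)
Lemma coincidencesE k l j s t : size s = size t ->
    count id s = j + k -> count id t = j + l -> common s t <= j ->
  coincidences k l s t = (common s t == j).
Proof.
move=> sz cs ct le_j; have [szm ms mt cm] := meetP sz.
have both z : z \in drops k s -> z \in drops l t ->
    [/\ size z = size (meet s t), below z (meet s t) & count id z = j].
  rewrite !mem_drops => /and3P[/eqP zs bs /eqP cz] /and3P[/eqP zt bt _].
  by split; [rewrite szm | exact: below_meet | lia].
rewrite /coincidences big_seq (eq_bigr (fun z => (z == meet s t) * (common s t == j))); last first.
  move=> z zt; rewrite count_uniq_mem ?uniq_drops //.
  have [zs|zNs] := boolP (z \in drops k s).
    have [sm bm cz] := both z zs zt; have le := below_count sm bm.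
    have e : common s t == j by apply/eqP; lia.
    by rewrite e muln1 (below_eq sm bm) ?eqxx //; lia.
  case: eqP => [ez|] //; case: eqP => // e; rewrite ez mem_drops szm sz eqxx ms in zNs.
  by rewrite cm cs e eqxx in zNs.
case: eqP => [e|_]; last by rewrite big1 // => z _; rewrite muln0.
have m_t : meet s t \in drops l t by rewrite mem_drops szm sz eqxx mt cm e ct eqxx.
rewrite -big_seq (bigD1_seq (meet s t)) ?uniq_drops //= eqxx big1 // => z /negbTE ->.
by [].
Qed.

Definition act (p : seq nat) (s : seq bool) : seq bool := [seq nth false s i | i <- p].

Section Act.
Variables (n : nat) (p : seq nat).
Hypothesis p_perm : perm_eq p (iota 0 n).

Let szp : size p = n. Proof. by rewrite (perm_size p_perm) size_iota. Qed.

Lemma perm_act s : size s = n -> perm_eq (act p s) s.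
Proof.
by move=> sz; rewrite -[X in perm_eq _ X](mkseq_nth false) sz; exact: perm_map.
Qed.

Lemma count_act s : size s = n -> count id (act p s) = count id s.
Proof. by move/perm_act/permP. Qed.

Lemma size_act s : size (act p s) = n.
Proof. by rewrite size_map. Qed.

Lemma act_inj s t : size s = n -> size t = n -> act p s = act p t -> s = t.
Proof.
move=> ss st /eq_in_map e; apply: (@eq_from_nth _ false); rewrite ss // => i lt_i.
by apply: e; rewrite (perm_mem p_perm) mem_iota.
Qed.

Lemma below_act z s : size z = n -> size s = n -> below (act p z) (act p s) = below z s.
Proof.
move=> sz ss; rewrite /below /act zip_map all_map.
rewrite (eq_all_r (perm_mem p_perm)).
rewrite -(@all_map _ _ (fun i => (nth false z i, nth false s i)) (fun e => e.1 ==> e.2)).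
rewrite -[in RHS](mkseq_nth false z) -[in RHS](mkseq_nth false s) sz ss /mkseq zip_map.
by [].
Qed.

(** Permuting coordinates and removing points commute, up to the order of the
    list. A set below the permuted support is pulled back through the inverse
    permutation. *)
Lemma drops_act k s : size s = n -> perm_eq (drops k (act p s)) (map (act p) (drops k s)).
Proof.
move=> ss; have inj : {in drops k s &, injective (act p)}.
  by move=> y z /size_in_drops sy /size_in_drops sz; apply: act_inj; rewrite ?sy ?sz.
have um : uniq (map (act p) (drops k s)) by rewrite map_inj_in_uniq ?uniq_drops.
apply: uniq_perm; rewrite ?uniq_drops // => z; apply/idP/mapP => [|[y]].
  rewrite mem_drops size_act count_act // => /and3P[/eqP sz bz cz].
  have [y [sy ey]] : exists y, size y = n /\ act p y = z.
    have up : uniq p by rewrite (perm_uniq p_perm) iota_uniq.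
    exists (mkseq (fun i => nth false z (index i p)) n); split; first exact: size_mkseq.
    apply: (@eq_from_nth _ false); rewrite size_act ?sz // => i lt_i.
    have pi : nth 0 p i < n.
      by have := mem_nth 0 (_ : i < size p); rewrite (perm_mem p_perm) mem_iota szp; apply.
    by rewrite (nth_map 0) ?szp // nth_mkseq // index_uniq ?szp.
  exists y; rewrite -?ey // mem_drops sy ss eqxx.
  by rewrite -ey below_act // count_act // in bz cz; rewrite bz cz.
rewrite mem_drops => /and3P[/eqP sy by_ cy] ->.
by rewrite mem_drops !size_act eqxx below_act ?sy ?ss // by_ !count_act ?sy ?ss //.
Qed.
End Act.

(** * Multisets of boolean lists *)

Inductive trie : Type := Void | Leaf of nat | Node of trie & trie.

(** Only trees of the same shape are merged; the last clause is a default. *)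
Fixpoint merge (t u : trie) : trie :=
  match t, u with
  | Void, x | x, Void => x
  | Leaf m, Leaf n => Leaf (m + n)
  | Node t0 t1, Node u0 u1 => Node (merge t0 u0) (merge t1 u1)
  | _, _ => Void
  end.

Fixpoint graft (s : seq bool) (t : trie) : trie :=
  if s is b :: s' then
    if b then Node Void (graft s' t) else Node (graft s' t) Void
  else t.

Fixpoint descend (t : trie) (s : seq bool) : trie :=
  if s is b :: s' then
    if t is Node t0 t1 then descend (if b then t1 else t0) s' else Void
  else t.

Definition occ (t : trie) (s : seq bool) : nat :=
  if descend t s is Leaf n then n else 0.

Fixpoint ins (s : seq bool) (t : trie) : trie :=
  if s is b :: s' then
    if t is Node t0 t1 then
      if b then Node t0 (ins s' t1) else Node (ins s' t0) t1
    else if b then Node Void (ins s' Void) else Node (ins s' Void) Void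
  else if t is Leaf n then Leaf n.+1 else Leaf 1.

Definition tally (l : seq (seq bool)) : trie := foldr ins Void l.

(** Walks down [t] along all the smaller sets at once, so that what [t] does not
    contain is abandoned at the first difference. Each subtree comes with the
    number of points that remain to be removed further on. *)
Fixpoint reach (k : nat) (t : trie) (s : seq bool) {struct s} : seq (nat * trie) :=
  if s is b :: s' then
    if t is Node t0 t1 then
      if b then
        (if k is k'.+1 then reach k' t0 s' else [::]) ++ reach k t1 s'
      else reach k t0 s'
    else [::]
  else if t is Void then [::] else [:: (k, t)].

Fixpoint shaped (n : nat) (t : trie) {struct t} : bool :=
  match t with
  | Void => true
  | Leaf _ => n == 0
  | Node t0 t1 => if n is m.+1 then shaped m t0 && shaped m t1 else false
  end.

Lemma descend_void s : descend Void s = Void.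
Proof. by case: s. Qed.

Lemma descend_nil t : descend t [::] = t.
Proof. by case: t. Qed.

Lemma occ_void s : occ Void s = 0.
Proof. by rewrite /occ descend_void. Qed.

Lemma descend_cat t s r : descend t (s ++ r) = descend (descend t s) r.
Proof.
by elim: s t => [|b s IH] t; case: t => [|m|t0 t1] //=; rewrite ?IH //; case: r {IH}.
Qed.

Lemma occ_cat t s r : occ t (s ++ r) = occ (descend t s) r.
Proof. by rewrite /occ descend_cat. Qed.

Lemma shaped_merge n t u : shaped n t -> shaped n u -> shaped n (merge t u).
Proof.
elim: t n u => [|m|t0 IH0 t1 IH1] n [|m'|u0 u1] //; case: n => // n.
by move=> /= /andP[s0 s1] /andP[r0 r1]; rewrite IH0 ?IH1.
Qed.

Lemma occ_merge n t u s : shaped n t -> shaped n u -> size s = n ->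
  occ (merge t u) s = occ t s + occ u s.
Proof.
elim: t n u s => [|m|t0 IH0 t1 IH1] [|n] [|m'|u0 u1] s; rewrite ?occ_void ?addn0 //.
  by case: s.
move=> /andP[s0 s1] /andP[r0 r1]; case: s => // b s [sz].
by rewrite /occ /=; case: b; [apply: (IH1 n)|apply: (IH0 n)].
Qed.

Lemma shaped_graft m n s t : size s = m -> shaped n t -> shaped (m + n) (graft s t).
Proof.
elim: s m => [|b s IH] [|m] // [sz] sh.
by rewrite addSn; case: b => /=; rewrite IH.
Qed.

Lemma occ_node t0 t1 b s : occ (Node t0 t1) (b :: s) = occ (if b then t1 else t0) s.
Proof. by []. Qed.

Lemma occ_graft v t v' u : size v = size v' ->
  occ (graft v t) (v' ++ u) = (v == v') * occ t u.
Proof.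
elim: v v' => [|b v IH] [|b' v'] // => [_|[sz]]; first by rewrite mul1n.
rewrite eqseq_cons cat_cons [graft _ _]/=.
by case: b; case: b'; rewrite occ_node ?occ_void ?IH.
Qed.

Lemma shaped_ins n s t : size s = n -> shaped n t -> shaped n (ins s t).
Proof.
elim: s n t => [|b s IH] [|n] t // sz sh; first by case: t sh.
case: sz => sz; case: t sh => [_|//|t0 t1 /= /andP[s0 s1]].
  by case: b; rewrite /= IH.
by case: b => /=; rewrite ?(IH n) ?s0 ?s1.
Qed.

Lemma occ_ins n s t z : size s = n -> shaped n t -> size z = n ->
  occ (ins s t) z = (s == z) + occ t z.
Proof.
elim: s n t z => [|b s IH] [|n] t [|b' z] // sz sh sz'; first by case: t sh.
case: sz => sz; case: sz' => sz'; rewrite eqseq_cons.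
case: t sh => [_|//|t0 t1 /= /andP[s0 s1]].
  by case: b; case: b'; rewrite /= occ_node ?(IH n) ?occ_void.
by case: b; case: b'; rewrite /= !occ_node ?(IH n).
Qed.

Lemma tallyP n l z : all (fun s => size s == n) l -> size z = n ->
  shaped n (tally l) && (occ (tally l) z == count (pred1 z) l).
Proof.
move=> szl szz; elim: l szl => [|s l IH] /=; first by rewrite occ_void.
case/andP=> /eqP sz /IH /andP[sh /eqP e].
by rewrite (shaped_ins sz sh) (occ_ins sz sh szz) e eqxx.
Qed.

(** The [k] points removed from [s ++ w] split into some from [s] and the rest from
    [w]; prefixes that [t] does not contain contribute nothing, by the hypothesis
    on [g]. *)
Lemma sum_reach n k t s w (g : seq bool -> trie -> nat) :
    (forall v, g v Void = 0) -> size s = n ->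
  \sum_(e <- reach k t s) \sum_(v <- drops e.1 w) g v e.2
  = \sum_(z <- drops k (s ++ w)) g (drop n z) (descend t (take n z)).
Proof.
move=> g0; elim: s n k t => [|b s IH] [|n] k t // sz.
  rewrite /= (eq_bigr (fun z => g z t)) => [|z _]; last by rewrite drop0 take0 descend_nil.
  by case: t => [|m|t0 t1]; rewrite ?big_seq1 // big_nil big1.
case: sz => sz; rewrite [_ ++ _]/= sum_drops_cons.
have none u c l : (forall x, descend u (c :: x) = Void) ->
    \sum_(z <- l) g (drop n.+1 (c :: z)) (descend u (take n.+1 (c :: z))) = 0.
  by move=> uv; rewrite big1 // => z _; rewrite [take _ _]/= uv g0.
case: t => [|m|t0 t1].
  by rewrite [reach _ _ _]/= big_nil !none //; case: b; case: k => // k; rewrite none.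
  by rewrite [reach _ _ _]/= big_nil !none //; case: b; case: k => // k; rewrite none.
have IH' k' t := IH n k' t sz; rewrite -IH'.
by case: b; case: k => [|k]; rewrite ?big_cat /= -?IH' ?add0n.
Qed.

(** * Counting for many permutations at once *)

Definition shadows (k : nat) (l : seq (seq bool)) : seq (seq bool) :=
  flatten [seq drops k s | s <- l].

(** For a support [s], the single-branch trees that start with the last eight
    coordinates of a set [z] obtained by removing [k] points from [s], and
    continue as the part of [t] that agrees with [z] on the first sixteen. *)
Definition strands (k : nat) (t : trie) (s : seq bool) : seq trie :=
  flatten [seq [seq graft v e.2 | v <- drops e.1 (drop 16 s)]
          | e <- reach k t (take 16 s)].

(** Superposes all the strands of a list: the entry at [v ++ u] counts the pairs
    of a set from the list ending in [v] and a set of [t] ending in [u] that agree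
    on the first sixteen coordinates. *)
Definition cross (k : nat) (t : trie) (l : seq (seq bool)) (m : trie) : trie :=
  foldr (fun s m => foldr merge m (strands k t s)) m l.

Fixpoint bools (n : nat) : seq (seq bool) :=
  if n is m.+1 then [seq true :: s | s <- bools m] ++ [seq false :: s | s <- bools m]
  else [:: [::]].

(** Sums the entries of the table in which the permutation carries the ending of
    the one set to that of the other. *)
Definition matches (m : trie) (p : seq nat) : nat :=
  sumn [seq occ m (v ++ act p v) | v <- bools 8].

Definition tail_perm (p : seq nat) : seq nat := iota 0 16 ++ [seq 16 + i | i <- p].

Lemma mem_bools n s : (s \in bools n) = (size s == n).
Proof.
elim: n s => [|n IH] [|b s]; rewrite ?inE // [bools _]/= mem_cat.
  by apply/negbTE; rewrite negb_or; apply/andP; split; apply/mapP => -[].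
by rewrite !(@mem_map_cons bool) !IH eqSS; case: b; rewrite ?orbF.
Qed.

Lemma bools_uniq n : uniq (bools n).
Proof.
have inj b : injective (cons b : seq bool -> _) by move=> x y [].
elim: n => //= n IH; rewrite cat_uniq !map_inj_uniq // IH /= andbT.
by apply/hasPn => _ /mapP[z _ ->]; apply/mapP => -[].
Qed.

Lemma all_flatten (T : Type) (a : pred T) (ss : seq (seq T)) :
  all a (flatten ss) = all (all a) ss.
Proof. by elim: ss => //= s ss <-; rewrite all_cat. Qed.

Lemma foldr_merge n m l s : shaped n m -> all (shaped n) l -> size s = n ->
  shaped n (foldr merge m l) /\ occ (foldr merge m l) s = occ m s + \sum_(t <- l) occ t s.
Proof.
move=> shm; elim: l => [|t l IH] /=; first by rewrite big_nil addn0.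
case/andP=> sht /IH{}IH sz; have [sh e] := IH sz.
by split; [exact: shaped_merge | rewrite (occ_merge sht sh sz) e big_cons addnCA].
Qed.

Lemma shaped_reach n m k t s : size s = m -> shaped (m + n) t ->
  all (fun e => shaped n e.2) (reach k t s).
Proof.
elim: s m k t => [|b s IH] [|m] k t // sz sh; first by case: t sh => //= *; rewrite andbT.
case: sz => sz; case: t sh => [||t0 t1] //= /andP[s0 s1].
by case: b; case: k => [|k]; rewrite ?all_cat /= ?(IH m).
Qed.

(** By [sum_reach], where the weight given to a subtree is the number of its
    branches equal to [u], restricted to the ending [v]. *)
Lemma sum_strands k t s v u : size s = 24 -> size v = 8 ->
  \sum_(x <- strands k t s) occ x (v ++ u)
  = \sum_(z <- drops k s) (drop 16 z == v) * occ t (take 16 z ++ u).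
Proof.
move=> szs szv; rewrite /strands big_flatten big_map.
have szt : size (take 16 s) = 16 by rewrite size_take szs.
rewrite (eq_bigr (fun e => \sum_(v' <- drops e.1 (drop 16 s)) (v' == v) * occ e.2 u)); last first.
  move=> e _; rewrite big_map big_seq [RHS]big_seq; apply: eq_bigr => v' /size_in_drops.
  by rewrite size_drop szs => sz'; rewrite occ_graft // sz' szv.
rewrite (sum_reach k t (drop 16 s) (g := fun v' t' => (v' == v) * occ t' u) _ szt); last first.
  by move=> v'; rewrite occ_void muln0.
by rewrite cat_take_drop; apply: eq_bigr => z _; rewrite occ_cat.
Qed.

Lemma cross_occ k t l m v u : shaped 24 t -> shaped 16 m ->
    all (fun s => size s == 24) l -> size v = 8 -> size u = 8 ->
  shaped 16 (cross k t l m) /\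
  occ (cross k t l m) (v ++ u)
  = occ m (v ++ u) + \sum_(s <- l) \sum_(z <- drops k s)
                       (drop 16 z == v) * occ t (take 16 z ++ u).
Proof.
move=> sht shm; elim: l => [|s l IH] /=; first by rewrite big_nil addn0.
case/andP=> /eqP szs /IH{}IH szv szu; have [sh e] := IH szv szu.
have szt : size (take 16 s) = 16 by rewrite size_take szs.
have all_sh : all (shaped 16) (strands k t s).
  rewrite /strands all_flatten all_map.
  apply: sub_all (@shaped_reach 8 16 k t (take 16 s) szt sht) => e' she /=.
  rewrite all_map; apply/allP => v' /size_in_drops; rewrite size_drop szs => sz' /=.
  exact: (@shaped_graft 8 8).
have szvu : size (v ++ u) = 16 by rewrite size_cat szv szu.
have [sh' e'] := foldr_merge sh all_sh szvu.
split=> //; rewrite e' e big_cons sum_strands //; ring.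
Qed.

Section Matches.
Variable p : seq nat.
Hypothesis p_perm : perm_eq p (iota 0 8).

Lemma tail_perm_perm : perm_eq (tail_perm p) (iota 0 24).
Proof.
have -> : iota 0 24 = iota 0 16 ++ [seq 16 + i | i <- iota 0 8] by [].
by rewrite perm_cat2l; exact: perm_map.
Qed.

Lemma act_tail z : size z = 24 -> act (tail_perm p) z = take 16 z ++ act p (drop 16 z).
Proof.
move=> sz; rewrite /act map_cat -map_comp; congr (_ ++ _).
  by apply: (@eq_from_nth _ false) => [|i]; rewrite size_map size_iota ?size_take ?sz // => lt_i;
     rewrite (nth_map 0) ?size_iota // nth_iota // nth_take.
by apply: eq_map => i /=; rewrite nth_drop.
Qed.

(** For a set [z] obtained from [y], the sum over [v] picks the ending of [z], and
    the entry there counts the sets of the tree equal to the permuted [z]. Since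
    removing points commutes with the permutation, the sum over [z] counts
    coincidences with the permuted [y]. *)
Lemma matches_cross k k1 lx ly m :
    all (fun s => size s == 24) lx -> all (fun s => size s == 24) ly -> shaped 16 m ->
  matches (cross k (tally (shadows k1 lx)) ly m) p
  = matches m p + \sum_(y <- ly) \sum_(x <- lx) coincidences k1 k x (act (tail_perm p) y).
Proof.
move=> szx szy shm; set t := tally _.
have szsh : all (fun s => size s == 24) (shadows k1 lx).
  apply/allP => z /flattenP[_ /mapP[x /(allP szx)/eqP sx ->]] /size_in_drops->.
  by rewrite sx.
have tP z : size z = 24 -> shaped 24 t /\ occ t z = count (pred1 z) (shadows k1 lx).
  by move=> sz; have /andP[-> /eqP->] := tallyP szsh sz.
have [sht _] := tP (nseq 24 false) (size_nseq _ _).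
have szp : size p = 8 by rewrite (perm_size p_perm) size_iota.
rewrite /matches !sumnE !big_map.
move: (bools 8) (bools_uniq 8) (mem_bools 8) => B uB mB; rewrite big_seq.
under eq_bigr => v; first rewrite mB => /eqP szv.
  have sza : size (act p v) = 8 by rewrite size_map.
  have [_ ->] := @cross_occ k t ly m v (act p v) sht shm szy szv sza.
  over.
rewrite -big_seq big_split /=; congr (_ + _).
rewrite exchange_big big_seq [RHS]big_seq; apply: eq_bigr => y /(allP szy)/eqP sy.
rewrite exchange_big [RHS]exchange_big (perm_big _ (drops_act tail_perm_perm k sy)) big_map.
rewrite big_seq [RHS]big_seq; apply: eq_bigr => z /size_in_drops; rewrite sy => sz.
have szd : size (drop 16 z) = 8 by rewrite size_drop sz.
(* Only the ending of [z] itself contributes to the sum over endings. *)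
rewrite (bigD1_seq (drop 16 z)) ?mB ?uB ?szd //= eqxx mul1n.
rewrite big1 ?addn0 => [|v /negbTE]; last by rewrite eq_sym => ->.
have szat : size (act (tail_perm p) z) = 24 by rewrite size_map (perm_size tail_perm_perm).
rewrite -act_tail //; have [_ ->] := tP _ szat.
by rewrite count_flatten sumnE !big_map.
Qed.

End Matches.

(** * Self-dual codes from generator matrices *)

Local Open Scope ring_scope.

Lemma inner_mulmx n (x y : 'rV[F3]_n) : inner x y = (x *m y^T) ord0 ord0.
Proof. by rewrite mxE; apply: eq_bigr => i _; rewrite mxE. Qed.

Lemma weight_sum n (x : 'rV[F3]_n) : weight x = (\sum_(i < n) (x ord0 i != 0%R))%N.
Proof.
by rewrite /weight -sum1_card big_mkcond; apply: eq_bigr => i _; rewrite inE; case: ifP.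
Qed.

Lemma weight_row_mx m n (x : 'rV[F3]_m) (y : 'rV[F3]_n) :
  weight (row_mx x y) = (weight x + weight y)%N.
Proof.
rewrite !weight_sum big_split_ord /=.
by congr (_ + _)%N; apply: eq_bigr => i _; rewrite ?row_mxEl ?row_mxEr.
Qed.

Lemma weight_eq0 n (x : 'rV[F3]_n) : (weight x == 0)%N = (x == 0).
Proof.
rewrite cards_eq0; apply/eqP/eqP => [/setP e|->].
  by apply/rowP => i; have := e i; rewrite !inE mxE => /negbFE/eqP.
by apply/setP => i; rewrite !inE mxE eqxx.
Qed.

Section GlueMatrix.
Variables (F : fieldType) (m n : nat) (X Y : 'M[F]_(m, n)).

Definition glue_mx : 'M[F]_(m + m, n + n) := block_mx X X Y (- Y).

Lemma mul_glue (u : 'rV[F]_(m + m)) : u *m glue_mx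
  = row_mx (lsubmx u *m X + rsubmx u *m Y) (lsubmx u *m X - rsubmx u *m Y).
Proof. by rewrite -{1}(hsubmxK u) mul_row_block (mulmxN (rsubmx u) Y). Qed.

(** The rows [(x | x)] and [(y | - y)] are orthogonal because the two halves
    cancel; within each kind, self-orthogonality of [X] and [Y] is used. *)
Lemma glue_isotropic : X *m X^T = 0 -> Y *m Y^T = 0 -> glue_mx *m glue_mx^T = 0.
Proof.
move=> XX0 YY0; rewrite tr_block_mx mulmx_block !linearN /= !mulNmx opprK.
by rewrite XX0 YY0 !addr0 !subrr block_mx0.
Qed.

(** Adding the equations [a + b = 0] and [a - b = 0] gives [2 a = 0]. *)
Lemma glue_free : 2%:R != 0 :> F -> row_free X -> row_free Y -> row_free glue_mx.
Proof.
move=> two /row_freeP[X' XX'] /row_freeP[Y' YY'].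
apply: inj_row_free => u uM0.
have /eq_row_mx[eD eB] := etrans (esym (mul_glue u)) (etrans uM0 (esym (row_mx0 _ _ n n))).
have eX : lsubmx u *m X = 0.
  apply: (scalerI two); rewrite scaler0 scaler_nat mulr2n.
  by have := congr2 +%R eD eB; rewrite addrACA subrr !addr0.
have eY : rsubmx u *m Y = 0 by move: eD; rewrite eX add0r.
rewrite -(hsubmxK u) -[lsubmx u]mulmx1 -XX' mulmxA eX mul0mx.
by rewrite -[rsubmx u]mulmx1 -YY' mulmxA eY mul0mx row_mx0.
Qed.

End GlueMatrix.

Section Code.
Variables (m n : nat) (M : 'M[F3]_(m, n)).

Definition row_code : {vspace 'rV[F3]_n} := limg (linfun (mulmxr M)).

Lemma mem_row_code (w : 'rV[F3]_n) :
  reflect (exists u : 'rV_m, w = u *m M) (w \in row_code).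
Proof.
apply: (iffP memv_imgP) => [[u _ ->]|[u ->]]; exists u; rewrite ?lfunE //.
exact: memvf.
Qed.

Hypothesis free : row_free M.

(** Self-orthogonality puts the row space inside the dual, and both have half the
    length as dimension. *)
Lemma row_code_self_dual : M *m M^T = 0 -> n = (m + m)%N -> self_dual row_code.
Proof.
move=> iso half.
have eqM : (M == kermx M^T)%MS.
  have sub : (M <= kermx M^T)%MS by apply/sub_kermxP.
  rewrite sub -(geq_leqif (mxrank_leqif_sup sub)) mxrank_ker mxrank_tr (eqP free).
  by rewrite half addnK leqnn.
move=> w; rewrite inE; apply/mem_row_code/forallP => [[u ->] w'|dual].
  apply/implyP => /mem_row_code[v ->]; rewrite inner_mulmx trmx_mul mulmxA -(mulmxA u).
  by rewrite iso mulmx0 mul0mx mxE.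
apply/submxP; rewrite (eqmxP eqM); apply/sub_kermxP/rowP => i.
(* The code is spanned by the rows of [M], and the i-th gives coordinate i of [w *m M^T]. *)
have := dual (delta_mx ord0 i *m M).
rewrite (introT (mem_row_code _)) /=; last by exists (delta_mx ord0 i).
rewrite inner_mulmx -rowE => /eqP; rewrite !mxE => e.
by rewrite -[RHS]e; apply: eq_bigr => j _; rewrite !mxE.
Qed.

Lemma card_row_code (P : pred nat) :
  #|[set w | (w \in row_code) && P (weight w)]|
  = #|[set u : 'rV_m | P (weight (u *m M))]|.
Proof.
rewrite -[RHS](card_imset _ (row_free_inj free)).
apply: eq_card => w; rewrite inE; apply/andP/imsetP => [[/mem_row_code[u ->] Pu]|[u]].
  by exists u; rewrite // inE.
by rewrite inE => Pu ->; split=> //; apply/mem_row_code; exists u.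
Qed.

End Code.

(** If only one of two entries is nonzero, neither their sum nor their difference
    vanishes; if both are, they are equal or opposite, and exactly one of the two
    vanishes. *)
Lemma weight_glue n (a b : 'rV[F3]_n) :
  (weight (a + b)%R + weight (a - b)%R
   + 3 * \sum_(i < n) ((a ord0 i != 0%R) && (b ord0 i != 0%R)))%N
  = (2 * weight a + 2 * weight b)%N.
Proof.
rewrite !weight_sum !big_distrr -!big_split /=; apply: eq_bigr => i _; rewrite !mxE.
by case: (F3P (a ord0 i)) => ->; case: (F3P (b ord0 i)) => ->.
Qed.

Local Close Scope ring_scope.

(** * Weights of the words (a + b | a - b) *)

Definition supp n (x : 'rV[F3]_n) : seq bool := [seq x ord0 i != 0%R | i <- enum 'I_n].

Definition glue_weight (s t : seq bool) : nat :=
  2 * count id s + 2 * count id t - 3 * common s t.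

Lemma size_supp n (x : 'rV[F3]_n) : size (supp x) = n.
Proof. by rewrite size_map size_enum_ord. Qed.

Lemma weight_supp n (x : 'rV[F3]_n) : weight x = count id (supp x).
Proof.
by rewrite /supp weight_sum -sumn_count sumnE big_map big_map; symmetry; exact: big_enum.
Qed.

Lemma common_supp n (a b : 'rV[F3]_n) :
  common (supp a) (supp b) = \sum_(i < n) ((a ord0 i != 0%R) && (b ord0 i != 0%R)).
Proof. by rewrite /common /supp -sumn_count sumnE zip_map big_map big_map; exact: big_enum. Qed.

Lemma weight_glue_supp n (a b : 'rV[F3]_n) :
  weight (a + b)%R + weight (a - b)%R = glue_weight (supp a) (supp b).
Proof. by rewrite /glue_weight common_supp -!weight_supp -weight_glue addnK. Qed.

Lemma glue_weight_le s t : count id s <= glue_weight s t /\ count id t <= glue_weight s t.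
Proof.
by have := common_le s t; have := common_le t s; rewrite commonC /glue_weight; lia.
Qed.

Section Generated.
Variables (m n : nat).

Definition gen (p : seq nat) (G : seq (seq trit)) : 'M[F3]_(m, n) :=
  (\matrix_(k, j) den (nth T0 (nth [::] G k) (nth 0 p j)))%R.

Lemma mul_gen p G (x : 'rV[F3]_m) j : size G = m ->
  (x *m gen p G)%R ord0 j = val_at (rowseq x) G (nth 0 p j).
Proof.
move=> szG; rewrite mxE /val_at.
have -> : zip (rowseq x) G = [seq (x ord0 k, nth [::] G k) | k <- enum 'I_m].
  rewrite -zip_map; congr zip; apply: (@eq_from_nth _ [::]).
    by rewrite size_map size_enum_ord.
  move=> i; rewrite szG => lt_i.
  by rewrite (nth_map (Ordinal lt_i)) ?size_enum_ord // nth_enum_ord.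
by rewrite big_map big_enum; apply: eq_bigr => k _; rewrite mxE.
Qed.

Lemma supp_mul_gen p G (x : 'rV[F3]_m) : size G = m -> perm_eq p (iota 0 n) ->
  supp (x *m gen p G)%R = act p (sup n (val_at (rowseq x) G)).
Proof.
move=> szG p_perm; have szp : size p = n by rewrite (perm_size p_perm) size_iota.
apply: (@eq_from_nth _ false); rewrite size_supp ?size_map ?szp // => i lt_i.
have := mem_nth 0 (_ : i < size p); rewrite (perm_mem p_perm) mem_iota szp => /(_ lt_i) lt_p.
rewrite (nth_map (Ordinal lt_i)) ?size_enum_ord // (nth_map 0) ?szp //.
by rewrite (nth_map 0) ?size_iota // nth_iota // mul_gen // nth_enum_ord.
Qed.

Definition tdot (u v : seq trit) : trit :=
  foldr tadd T0 [seq tmul e.1 e.2 | e <- zip u v].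

Definition isotropic (G : seq (seq trit)) : bool :=
  all (fun u => all (fun v => ~~ nonzero (tdot u v)) G) G.

Lemma den_tdot u v : size u = n -> size v = n ->
  den (tdot u v) = (\sum_(i <- iota 0 n) den (nth T0 u i) * den (nth T0 v i))%R.
Proof.
move=> su sv.
have -> : den (tdot u v) = (\sum_(e <- zip u v) den e.1 * den e.2)%R.
  rewrite /tdot; elim: (zip u v) => [|e l IH] /=; first by rewrite big_nil.
  by rewrite denD denM IH big_cons.
rewrite -{1}(mkseq_nth T0 u) -{1}(mkseq_nth T0 v) su sv /mkseq zip_map big_map.
by [].
Qed.

(** Rearranging the columns does not change inner products. *)
Lemma gen_isotropic p G : size G = m -> all (fun r => size r == n) G ->
  perm_eq p (iota 0 n) -> isotropic G -> (gen p G *m (gen p G)^T = 0)%R.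
Proof.
move=> szG sz p_perm iso; have szp : size p = n by rewrite (perm_size p_perm) size_iota.
apply/matrixP => k l; rewrite [RHS]mxE mxE.
pose u := nth [::] G k; pose v := nth [::] G l.
have lt i : (i : 'I_m) < size G by rewrite szG.
have /eqP su := all_nthP [::] sz k (lt k); have /eqP sv := all_nthP [::] sz l (lt l).
have := all_nthP [::] (all_nthP [::] iso k (lt k)) l (lt l).
rewrite nonzeroE negbK den_tdot // => /eqP {2}<-.
rewrite -(perm_big _ p_perm) /= (big_nth 0) szp big_mkord.
by apply: eq_bigr => j _; rewrite !mxE.
Qed.

(** By [sum_supports], the zero combination is the only one of weight 0, because
    no listed support is empty. *)
Lemma gen_free p G : size G = m -> all (fun r => size r == n) G ->
  perm_eq p (iota 0 n) -> all (fun s => 0 < count id s) (supports G) -> row_free (gen p G).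
Proof.
move=> szG sz p_perm pos.
pose Z := [set x : 'rV[F3]_m | weight (x *m gen p G)%R == 0].
have Z1 : #|Z| = 1.
  rewrite -sum1_card big_mkcond /=.
  under eq_bigr do rewrite inE weight_supp supp_mul_gen // (count_act p_perm)
    ?size_map ?size_iota //.
  rewrite (sum_rowseq _ (fun c => if count id (sup n (val_at c G)) == 0 then 1 else 0)).
  rewrite -szG (eq_bigr (fun c => cut (fun s => (count id s == 0) : nat) (sup n (val_at c G)))).
    rewrite sum_supports // count_nseq mul0n eqxx big1_seq // => s /andP[_ /(allP pos)].
    by case: (count id s).
  by move=> c _; rewrite /cut; case: eqP => [->|]; rewrite ?if_same.
apply: inj_row_free => x x0; have Z0 : 0%R \in Z by rewrite inE mul0mx weight_eq0.
have xZ : x \in Z by rewrite inE x0 weight_eq0.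
by have /eqP/cards1P[z Zz] := Z1; move: xZ Z0; rewrite Zz !inE => /eqP-> /eqP.
Qed.

End Generated.

Lemma size_spread n rows v acc : size v = n -> all (fun r => size r == n) rows ->
  all (fun s => size s == n) acc -> all (fun s => size s == n) (spread rows v acc).
Proof.
elim: rows v acc => [|r rs IH] v acc szv.
  by rewrite /= /keep; case: ifP => //= _ _ ->; rewrite size_map szv eqxx.
case/andP=> /eqP szr szrs sza; rewrite spread_cons ?szr //.
have sz1 : size (vadd v r) = n by rewrite size_vadd szv ?szr.
have sz2 : size (vadd v (map topp r)) = n by rewrite size_vadd szv ?size_map ?szr.
exact: IH szv szrs (IH _ _ sz1 szrs (IH _ _ sz2 szrs sza)).
Qed.

Lemma size_supports n rows : all (fun r => size r == n) rows ->
  all (fun s => size s == n) (supports rows).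
Proof.
by elim: rows => //= r rs IH /andP[/eqP szr szrs]; rewrite (size_spread szr) ?IH.
Qed.

Lemma act_iota n s : size s = n -> act (iota 0 n) s = s.
Proof. by move=> <-; exact: mkseq_nth. Qed.

Definition layer (w : nat) (l : seq (seq bool)) : seq (seq bool) :=
  [seq s <- l | count id s == w].

Section GluedWords.
Variables (m n : nat) (GX GY : seq (seq trit)) (p : seq nat).
Hypotheses (szX : size GX = m) (szY : size GY = m).
Hypotheses (rowsX : all (fun r => size r == n) GX) (rowsY : all (fun r => size r == n) GY).
Hypothesis p_perm : perm_eq p (iota 0 n).

Let X := gen m n (iota 0 n) GX.
Let Y := gen m n p GY.
Let ss := supports GX.
Let tt := supports GY.

Lemma glue_weight_empty s : glue_weight s (act p (nseq n false)) = 2 * count id s.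
Proof.
have e : count id (act p (nseq n false)) = 0.
  by rewrite (count_act p_perm) ?size_nseq // count_nseq.
by rewrite /glue_weight e; have := common_le (act p (nseq n false)) s; rewrite commonC e; lia.
Qed.

(** Summation over the pairs [(a, b)], by two applications of [sum_supports]: the
    four terms are [a = b = 0], [a = 0], [b = 0], and both nonzero, with a factor 2
    for every sign. The restriction to light words is harmless because [P]
    vanishes above 12 and the weight dominates those of [a] and [b]. *)
Lemma card_glued (P : pred nat) : (forall w, 12 < w -> P w = false) ->
  #|[set u : 'rV[F3]_(m + m) | P (weight (u *m glue_mx X Y)%R)]|
  = P 0 + 2 * \sum_(t <- tt) P (2 * count id t) + 2 * \sum_(s <- ss) P (2 * count id s)
    + 4 * \sum_(s <- ss) \sum_(t <- tt) P (glue_weight s (act p t)).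
Proof.
move=> P12; have P_small s t : 12 < count id s \/ 12 < count id t -> P (glue_weight s t) = false.
  by move=> big; apply: P12; have := glue_weight_le s t; lia.
pose f q c := P (glue_weight (sup n (val_at q GX)) (act p (sup n (val_at c GY)))) : nat.
transitivity (\sum_(q <- vecs m) \sum_(c <- vecs m) f q c).
  rewrite -sum1_card big_mkcond /=.
  transitivity (\sum_(u : 'rV[F3]_(m + m)) f (rowseq (lsubmx u)) (rowseq (rsubmx u))).
    apply: eq_bigr => u _; rewrite inE mul_glue weight_row_mx weight_glue_supp /f.
    by rewrite !supp_mul_gen // act_iota ?size_map ?size_iota //; case: (P _).
  rewrite (sum_row_mx (fun x y => f (rowseq x) (rowseq y))).
  rewrite -(sum_rowseq m (fun q => \sum_(c <- vecs m) f q c)).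
  by apply: eq_bigr => x _; rewrite -(sum_rowseq m).
(* The inner sum as a function of the support of [a], in the form that
   [sum_supports] expects. *)
pose F s := \sum_(c <- vecs m) cut (fun t => P (glue_weight s (act p t)) : nat)
                                   (sup n (val_at c GY)).
have FE s : F s = P (2 * count id s) + 2 * \sum_(t <- tt) P (glue_weight s (act p t)).
  by rewrite /F -szY sum_supports // glue_weight_empty.
have cE q c : f q c = cut (fun t => P (glue_weight (sup n (val_at q GX)) (act p t)) : nat)
                          (sup n (val_at c GY)).
  rewrite /f /cut; case: leqP => // big; rewrite P_small //; right.
  by rewrite (count_act p_perm) ?size_map ?size_iota.
transitivity (\sum_(q <- vecs m) cut F (sup n (val_at q GX))).
  apply: eq_bigr => q _; rewrite /cut; case: leqP => big.
    by apply: eq_bigr => c _; rewrite cE.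
  by rewrite big1 // => c _; rewrite /f P_small //; left.
rewrite -{1}szX sum_supports // FE count_nseq mul0n muln0.
under [in X in _ + 2 * X]eq_bigr do rewrite FE.
rewrite big_split /= -big_distrr /= mulnDr mulnA addnA; congr (_ + _ + _ + _).
congr (2 * _); rewrite big_seq [RHS]big_seq; apply: eq_bigr => t t_in.
have := glue_weight_empty (act p t); rewrite /glue_weight.
have e : count id (nseq n false) = 0 by rewrite count_nseq.
have := common_le (nseq n false) (act p t); rewrite e.
have /eqP szt := allP (size_supports rowsY) t t_in.
by rewrite (count_act p_perm szt) muln0 add0n => *; congr nat_of_bool; congr P; lia.
Qed.

End GluedWords.

(** The pairs of supports of sizes [v] and [w] that coincide after removing [k]
    and [l] points. In the cases of interest [v - k = w - l] is the prescribed
    size of the intersection. *)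
Definition incidences (k l v w : nat) (p : seq nat) (ss tt : seq (seq bool)) : nat :=
  \sum_(t <- layer w tt) \sum_(s <- layer v ss) coincidences k l s (act p t).

Lemma incidencesE k l v w p ss tt : incidences k l v w p ss tt
  = \sum_(s <- ss) \sum_(t <- tt)
      ((count id s == v) && (count id t == w)) * coincidences k l s (act p t).
Proof.
rewrite /incidences exchange_big !big_filter big_mkcond; apply: eq_bigr => s _.
case: eqP => [_|_]; last by rewrite big1.
rewrite big_filter big_mkcond; apply: eq_bigr => t _.
by rewrite andTb; case: ifP; rewrite ?mul1n.
Qed.

Section Certificate.
Variables (m n : nat) (GX GY : seq (seq trit)) (p : seq nat).
Hypotheses (szX : size GX = m) (szY : size GY = m).
Hypotheses (rowsX : all (fun r => size r == n) GX) (rowsY : all (fun r => size r == n) GY).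
Hypothesis p_perm : perm_eq p (iota 0 n).

Let ss := supports GX.
Let tt := supports GY.

Hypothesis weightX : all (fun s => count id s \in [:: 6; 9; 12]) ss.
Hypothesis weightY : all (fun t => count id t \in [:: 9; 12]) tt.

Definition glued : 'M[F3]_(m + m, n + n) := glue_mx (gen m n (iota 0 n) GX) (gen m n p GY).

Lemma glued_free : row_free glued.
Proof.
apply: glue_free => //; apply: gen_free => //.
  by apply/allP => s /(allP weightX); case: (count id s).
by apply/allP => s /(allP weightY); case: (count id s).
Qed.

Lemma glued_self_dual : isotropic GX -> isotropic GY -> n = m + m ->
  self_dual (row_code glued).
Proof.
move=> isoX isoY half; apply: row_code_self_dual; first exact: glued_free.
  by apply: glue_isotropic; apply: gen_isotropic.
by rewrite -half.
Qed.

Hypothesis no_bad : incidences 0 0 9 9 p ss tt = 0.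

(** In particular, supports of size 9 meet in at most 8 points, since a shared
    support would be a coincidence without removal. *)
Lemma common_bound s t : s \in ss -> t \in tt ->
  [/\ size s = size (act p t), count id (act p t) = count id t,
      common s (act p t) <= count id s, common s (act p t) <= count id t
    & count id s = 9 -> count id t = 9 -> common s (act p t) <= 8].
Proof.
move=> s_in t_in; have /eqP szs := allP (size_supports rowsX) s s_in.
have /eqP szt := allP (size_supports rowsY) t t_in.
have sz : size s = size (act p t) by rewrite szs size_map (perm_size p_perm) size_iota.
have ct := count_act p_perm szt.
have le1 := common_le s (act p t).
have le2 : common s (act p t) <= count id t by rewrite commonC -ct common_le.
split=> // s9 t9; rewrite leqNgt; apply/negP => gt8.
have e9 : common s (act p t) == 9 by apply/eqP; lia.
have C : coincidences 0 0 s (act p t) = 1.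
  by rewrite (@coincidencesE 0 0 9) ?e9 ?ct ?s9 ?t9 //; lia.
move: no_bad; rewrite incidencesE (big_rem _ s_in) (big_rem _ t_in) /= s9 t9 C.
by [].
Qed.

(** With sizes [i] and [j] the weight is [2 i + 2 j - 3 I]. It equals 12 for
    [(6, 9)] if [I = 6], for [(9, 9)] if [I = 8] and for [(12, 12)] if [I = 12];
    the other pairs of sizes would need [I] larger than the smaller size. *)
Lemma card_weight12 :
  #|[set u : 'rV[F3]_(m + m) | weight (u *m glued)%R == 12]|
  = 2 * (count (fun s => count id s == 6) ss
         + 2 * (incidences 0 3 6 9 p ss tt + incidences 1 1 9 9 p ss tt
                + incidences 0 0 12 12 p ss tt)).
Proof.
rewrite (@card_glued m n _ _ p _ _ _ _ _ (pred1 12)) // => [|w]; last by move=> lt /=; lia.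
have -> : \sum_(t <- tt) pred1 12 (2 * count id t) = 0.
  by rewrite big1_seq // => t /andP[_ /(allP weightY)]; rewrite !inE => /orP[]/eqP->.
have -> : \sum_(s <- ss) pred1 12 (2 * count id s) = count (fun s => count id s == 6) ss.
  rewrite -sumn_count sumnE big_map; apply: eq_bigr => s _; congr nat_of_bool => /=.
  lia.
have -> : \sum_(s <- ss) \sum_(t <- tt) pred1 12 (glue_weight s (act p t))
   = incidences 0 3 6 9 p ss tt + incidences 1 1 9 9 p ss tt + incidences 0 0 12 12 p ss tt.
  rewrite !incidencesE -!big_split big_seq [RHS]big_seq; apply: eq_bigr => s s_in /=.
  rewrite -!big_split big_seq [RHS]big_seq; apply: eq_bigr => t t_in /=.
  have [sz ct le1 le2 le3] := common_bound s_in t_in.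
  have := allP weightX s s_in; have := allP weightY t t_in; rewrite /glue_weight ct !inE.
  case/orP=> /eqP t_w /or3P[] /eqP s_w; rewrite s_w t_w in le1 le2 le3 *;
    rewrite /= ?mul0n ?mul1n ?add0n ?addn0.
  - rewrite (@coincidencesE 0 3 6) ?ct ?s_w ?t_w //; congr nat_of_bool; lia.
  - have := le3 erefl erefl => {}le3.
    rewrite (@coincidencesE 1 1 8) ?ct ?s_w ?t_w //; congr nat_of_bool; lia.
  - by apply/eqP; rewrite eqb0; lia.
  - by apply/eqP; rewrite eqb0; lia.
  - by apply/eqP; rewrite eqb0; lia.
  rewrite (@coincidencesE 0 0 12) ?ct ?s_w ?t_w //; congr nat_of_bool; lia.
by rewrite [nat_of_bool _]/= muln0 !add0n; set a := count _ _; set b := _ + _; lia.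
Qed.

(** The count of [card_glued] for weights below 12 reduces to its first term, the
    zero word. *)
Lemma weight_lt12 (u : 'rV[F3]_(m + m)) : weight (u *m glued)%R < 12 -> u = 0%R.
Proof.
pose Z := [set u : 'rV[F3]_(m + m) | weight (u *m glued)%R < 12].
have Z1 : #|Z| == 1.
  rewrite /Z (@card_glued m n _ _ p _ _ _ _ _ (fun w => w < 12)) // => [|w]; last by lia.
  rewrite !big1_seq //.
  - move=> s /andP[_ s_in]; rewrite big1_seq // => t /andP[_ t_in].
    have [sz ct le1 le2 le3] := common_bound s_in t_in.
    have := allP weightX s s_in; have := allP weightY t t_in; rewrite /glue_weight ct !inE.
    case/orP=> /eqP t_w /or3P[] /eqP s_w; rewrite s_w t_w in le1 le2 le3 *;
      apply/eqP; rewrite eqb0; lia.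
  - by move=> s /andP[_ /(allP weightX)]; rewrite !inE => /or3P[]/eqP->.
  by move=> s /andP[_ /(allP weightY)]; rewrite !inE => /orP[]/eqP->.
move=> lt12; have uZ : u \in Z by rewrite inE.
have Z0 : 0%R \in Z by rewrite inE mul0mx (eqP (_ : weight 0%R == 0)) // weight_eq0.
by have /cards1P[z Zz] := Z1; move: uZ Z0; rewrite Zz !inE => /eqP-> /eqP.
Qed.

End Certificate.

(** * Checking a code and its permutations *)

(** Rows are stored as numbers in base 3, lowest digit first, with the digit 2
    for -1. *)
Fixpoint digits (k : nat) (x : N) : seq trit :=
  if k is k'.+1 then
    let (q, r) := N.div_eucl x 3%num in
    (match r with N0 => T0 | Npos xH => T1 | _ => T2 end) :: digits k' q
  else [::].

(** Sizes are stored with the supports so that they are computed only once. *)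
Definition weigh (l : seq (seq bool)) : seq (nat * seq bool) := [seq (count id s, s) | s <- l].

Definition of_weight (w : nat) (l : seq (nat * seq bool)) : seq (seq bool) :=
  [seq e.2 | e <- l & e.1 == w].

Definition incidence_table k l v w (lx ly : seq (nat * seq bool)) (m : trie) : trie :=
  cross l (tally (shadows k (of_weight v lx))) (of_weight w ly) m.

Definition bad_table lx ly : trie := incidence_table 0 0 9 9 lx ly Void.

Definition good_table lx ly : trie :=
  incidence_table 0 3 6 9 lx ly
    (incidence_table 1 1 9 9 lx ly (incidence_table 0 0 12 12 lx ly Void)).

Definition family : Type := seq N * seq (nat * seq nat).

(** The last equation is half of [card_weight12], with [A_12 = 8 beta]. *)
Definition check_family (ly : seq (nat * seq bool)) (f : family) : bool :=
  let G := map (digits 24) f.1 in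
  let lx := weigh (supports G) in
  let bad := bad_table lx ly in
  let good := good_table lx ly in
  let n6 := count (fun e => e.1 == 6) lx in
  [&& size G == 12, isotropic G, all (fun e => e.1 \in [:: 6; 9; 12]) lx &
    all (fun e => [&& perm_eq e.2 (iota 0 8), matches bad e.2 == 0
                    & n6 + 2 * matches good e.2 == 4 * e.1]) f.2].

(** The second code is enumerated once for all the families, and each table
    serves all the permutations of its family. *)
Definition check (Y : seq N) (fs : seq family) : bool :=
  let G := map (digits 24) Y in
  let ly := weigh (supports G) in
  [&& size G == 12, isotropic G, all (fun e => e.1 \in [:: 9; 12]) ly
    & all (check_family ly) fs].

Lemma size_digits k x : size (digits k x) = k.
Proof. by elim: k x => //= k IH x; case: N.div_eucl => q r /=; rewrite IH. Qed.

Lemma of_weight_weigh w l : of_weight w (weigh l) = layer w l.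
Proof. by rewrite /of_weight /weigh filter_map -map_comp map_id. Qed.

Lemma shaped_cross k t l m : shaped 24 t -> shaped 16 m ->
  all (fun s => size s == 24) l -> shaped 16 (cross k t l m).
Proof.
move=> sht shm sz.
by have [] := cross_occ k sht shm sz (size_nseq 8 false) (size_nseq 8 false).
Qed.

Section Tables.
Variables (ss tt : seq (seq bool)).
Hypotheses (sz_ss : all (fun s => size s == 24) ss) (sz_tt : all (fun s => size s == 24) tt).

Let sz_layer w l : all (fun s => size s == 24) l -> all (fun s => size s == 24) (layer w l).
Proof. by move/allP=> sz; apply/allP => s; rewrite mem_filter => /andP[_ /sz]. Qed.

Lemma shaped_incidence_table k l v w m : shaped 16 m ->
  shaped 16 (incidence_table k l v w (weigh ss) (weigh tt) m).
Proof.
move=> shm; rewrite /incidence_table !of_weight_weigh.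
apply: shaped_cross => //; last exact: sz_layer.
have szs : all (fun s => size s == 24) (shadows k (layer v ss)).
  apply/allP => z /flattenP[_ /mapP[x /(allP (sz_layer v sz_ss))/eqP sx ->]] /size_in_drops->.
  by rewrite sx.
by have /andP[] := tallyP szs (size_nseq 24 false).
Qed.

Lemma matches_incidence_table k l v w m p : perm_eq p (iota 0 8) -> shaped 16 m ->
  matches (incidence_table k l v w (weigh ss) (weigh tt) m) p
  = matches m p + incidences k l v w (tail_perm p) ss tt.
Proof.
move=> p_perm shm; rewrite /incidence_table !of_weight_weigh.
by rewrite (matches_cross p_perm) ?sz_layer.
Qed.

Lemma matches_void p : matches Void p = 0.
Proof. by rewrite /matches sumnE big_map big1 // => v _; rewrite occ_void. Qed.

Lemma matches_bad p : perm_eq p (iota 0 8) ->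
  matches (bad_table (weigh ss) (weigh tt)) p = incidences 0 0 9 9 (tail_perm p) ss tt.
Proof. by move=> p_perm; rewrite matches_incidence_table // matches_void. Qed.

Lemma matches_good p : perm_eq p (iota 0 8) ->
  matches (good_table (weigh ss) (weigh tt)) p
  = incidences 0 3 6 9 (tail_perm p) ss tt + incidences 1 1 9 9 (tail_perm p) ss tt
    + incidences 0 0 12 12 (tail_perm p) ss tt.
Proof.
move=> p_perm; rewrite /good_table !matches_incidence_table ?shaped_incidence_table //.
by rewrite matches_void; ring.
Qed.

End Tables.

Lemma checked_code Y fs f e : check Y fs -> f \in fs -> e \in f.2 -> 0 < e.1 ->
  exists C : ternary_code 48,
    near_extremal_self_dual C /\ num_weight C 12 = 8 * e.1.
Proof.
case/and4P=> /eqP szY isoY wY /allP checks f_in e_in e_pos.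
case/and4P: (checks f f_in) => /eqP szX isoX wX /allP/(_ e e_in)/and3P[p_perm bad good].
set GX := map (digits 24) f.1 in szX isoX wX bad good.
set GY := map (digits 24) Y in szY isoY wY bad good.
have rows l : all (fun r => size r == 24) (map (digits 24) l).
  rewrite all_map; apply/allP => x _; apply/eqP; exact: size_digits.
have sz_ss := size_supports (rows f.1); have sz_tt := size_supports (rows Y).
rewrite -/GX in sz_ss; rewrite -/GY in sz_tt.
rewrite (matches_bad sz_ss sz_tt p_perm) in bad; move/eqP in bad.
rewrite (matches_good sz_ss sz_tt p_perm) in good.
rewrite /weigh !all_map in wX wY; rewrite /weigh count_map in good.
have tp := tail_perm_perm p_perm.
pose M := glued 12 24 GX GY (tail_perm e.2).
have free : row_free M := glued_free szX szY (rows _) (rows _) tp wX wY.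
have num12 : #|[set w | (w \in row_code M) && (weight w == 12)]| = 8 * e.1.
  rewrite (card_row_code free (pred1 12)).
  rewrite (card_weight12 szX szY (rows _) (rows _) tp wX wY bad).
  by move/eqP: good => /= ->; rewrite mulnA.
exists (row_code M); split; last exact: num12.
split=> //; first exact: (glued_self_dual szX szY (rows _) (rows _) tp wX wY isoX isoY).
split.
  have /card_gt0P[w] : 0 < #|[set w | (w \in row_code M) && (weight w == 12)]|.
    by rewrite num12 muln_gt0.
  by rewrite inE => /andP[wC /eqP w12]; exists w; split=> //; rewrite -weight_eq0 w12.
move=> w /mem_row_code[u ->]; apply: contraNT; rewrite -ltnNge => lt12.
by rewrite (weight_lt12 szX szY (rows _) (rows _) tp wX wY bad lt12) mul0mx.
Qed.

(** * The codes *)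

Definition fixed_code : seq N :=
  [:: 131044847545; 138986701851; 101798055000; 53576161560; 36692812485; 106247810727;
      213206158314; 81656443278; 204779104209; 77802982083; 168887757321; 223894144683]%num.

Definition entry (b : nat) (p0 p1 p2 p3 p4 p5 p6 p7 : nat) : nat * seq nat :=
  (b, [:: p0; p1; p2; p3; p4; p5; p6; p7]).

(** Each first code comes with its list of entries: a value of beta and the
    permutation of the last eight coordinates of [fixed_code] that realises it. *)
Definition moving_codes : seq family :=
  [::
   ([:: 7710146029; 240617352927; 117403288524; 7534770525; 263833884531; 138337812630;
       7287651162; 86037111441; 7885528119; 615428361; 7845722532; 158096965914]%num,
    [:: entry 374 4 5 3 6 7 0 1 2; entry 378 5 6 4 1 0 7 2 3; entry 384 4 7 1 5 6 0 3 2;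
      entry 386 4 5 3 6 0 7 1 2; entry 388 5 7 1 2 0 3 6 4; entry 390 1 0 4 2 7 3 5 6;
      entry 392 0 3 4 5 7 6 2 1; entry 394 3 6 4 5 7 0 2 1; entry 396 1 3 5 4 6 7 0 2;
      entry 398 1 3 7 4 6 5 0 2; entry 400 3 1 7 4 6 0 5 2; entry 402 0 5 1 2 4 6 3 7;
      entry 404 0 3 4 1 5 6 2 7; entry 406 0 1 5 6 4 7 2 3; entry 408 0 5 1 2 3 4 6 7;
      entry 410 0 3 5 4 7 6 2 1; entry 412 0 5 3 7 4 6 1 2; entry 414 0 1 7 4 3 6 2 5;
      entry 416 0 3 1 7 5 4 6 2; entry 418 0 1 3 4 7 6 2 5; entry 420 0 1 3 6 7 4 2 5;
      entry 422 0 1 2 4 7 6 5 3; entry 424 0 1 2 6 5 7 3 4; entry 426 0 1 3 6 5 4 2 7;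
      entry 428 0 1 2 6 7 3 5 4; entry 430 0 1 4 3 7 6 2 5; entry 432 0 1 2 3 5 7 4 6;
      entry 434 0 1 4 2 7 5 3 6; entry 436 0 1 4 2 5 3 6 7; entry 438 0 1 2 3 5 6 4 7;
      entry 440 0 1 3 6 5 7 2 4; entry 442 0 1 2 5 7 6 4 3; entry 444 0 1 2 4 5 6 3 7;
      entry 446 0 1 2 3 5 7 6 4; entry 448 0 1 2 4 5 6 7 3; entry 450 0 1 2 4 7 3 5 6;
      entry 452 0 1 3 2 5 7 6 4; entry 454 0 1 2 3 5 4 6 7; entry 456 0 1 2 4 5 7 3 6;
      entry 458 0 1 2 4 7 5 3 6; entry 460 0 1 2 3 7 6 5 4; entry 462 0 1 2 3 7 5 4 6;
      entry 464 0 1 2 3 7 5 6 4; entry 466 0 1 2 5 7 3 6 4; entry 468 0 1 2 3 5 6 7 4;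
      entry 470 0 1 2 3 5 4 7 6; entry 472 0 1 2 4 5 3 6 7; entry 474 0 1 2 7 5 3 4 6;
      entry 476 0 1 2 6 5 3 4 7; entry 478 0 1 2 3 7 4 6 5; entry 480 0 1 3 6 5 2 4 7;
      entry 482 0 1 2 3 7 4 5 6; entry 484 0 1 3 6 7 5 4 2; entry 486 0 1 3 4 5 2 7 6;
      entry 488 0 1 2 4 7 3 6 5; entry 490 0 1 3 2 5 4 7 6; entry 492 0 1 4 3 5 6 7 2;
      entry 494 0 1 4 3 5 2 7 6; entry 496 0 1 5 6 3 4 7 2; entry 498 0 1 4 2 7 3 6 5;
      entry 500 0 1 4 5 7 6 3 2; entry 504 0 1 4 3 7 2 6 5; entry 506 0 1 2 5 7 4 3 6;
      entry 512 0 1 7 5 2 6 4 3; entry 516 0 1 7 6 3 5 4 2; entry 518 0 1 3 2 5 6 7 4;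
      entry 522 0 2 4 3 7 5 6 1; entry 524 0 1 4 3 7 2 5 6; entry 528 0 1 5 2 4 3 7 6;
      entry 536 0 2 7 4 1 6 3 5; entry 554 1 5 6 0 4 7 2 3; entry 560 0 6 5 3 7 2 4 1]);
   ([:: 14249330704; 235251826176; 160307110944; 14679601110; 160264202076; 272099386566;
       173349323343; 71028154719; 28799640720; 110674714014; 133923132000; 243185275836]%num,
    [:: entry 359 4 7 5 6 2 1 0 3; entry 361 0 7 4 1 2 3 5 6; entry 363 0 7 4 1 2 6 5 3;
      entry 365 0 2 3 4 6 5 1 7; entry 367 0 2 4 1 3 5 6 7; entry 369 0 2 1 4 6 5 3 7;
      entry 371 0 2 3 5 6 4 1 7; entry 373 0 4 2 5 3 1 6 7; entry 375 0 2 1 5 7 6 4 3;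
      entry 377 0 1 3 6 2 4 5 7; entry 379 0 1 2 6 3 4 5 7; entry 381 0 2 1 5 3 4 6 7;
      entry 383 0 1 4 6 3 2 5 7; entry 385 0 1 2 4 7 3 5 6; entry 387 0 1 2 3 6 4 5 7;
      entry 389 0 1 2 5 3 4 6 7; entry 391 0 1 3 4 7 5 2 6; entry 393 0 1 6 4 5 3 7 2;
      entry 395 0 1 2 4 6 5 3 7; entry 397 0 1 3 6 2 7 5 4; entry 399 0 1 4 6 2 3 5 7;
      entry 401 0 1 2 4 7 6 3 5; entry 403 0 1 2 6 5 4 3 7; entry 405 0 1 3 2 5 4 6 7;
      entry 407 0 1 2 4 7 3 6 5; entry 409 0 1 2 3 6 5 7 4; entry 411 0 1 2 4 3 5 6 7;
      entry 413 0 1 2 3 5 4 6 7; entry 415 0 1 2 3 7 6 4 5; entry 417 0 1 2 6 7 3 5 4;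
      entry 419 0 1 2 3 7 5 4 6; entry 421 0 1 2 3 5 6 7 4; entry 423 0 1 3 2 4 5 7 6;
      entry 425 0 1 2 3 4 6 7 5; entry 427 0 1 3 7 4 6 5 2; entry 429 0 1 2 5 7 3 4 6;
      entry 431 0 1 2 6 3 5 4 7; entry 433 0 1 4 5 3 6 7 2; entry 435 0 1 3 5 2 6 7 4;
      entry 437 0 1 2 3 4 5 7 6; entry 439 0 1 4 7 3 6 2 5; entry 441 0 2 6 1 4 3 7 5;
      entry 443 0 1 3 2 4 6 7 5; entry 445 0 1 3 5 4 2 7 6; entry 447 0 1 3 5 4 6 7 2;
      entry 449 0 1 2 6 4 5 3 7; entry 451 0 1 2 5 6 3 7 4; entry 453 0 1 2 5 7 3 6 4;
      entry 455 0 1 2 3 4 5 6 7; entry 457 0 2 3 1 6 4 7 5; entry 459 0 2 5 1 3 4 7 6;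
      entry 461 0 2 5 4 3 1 7 6; entry 463 0 2 3 4 6 1 7 5; entry 465 0 2 6 1 3 4 7 5;
      entry 471 0 2 6 4 3 1 7 5; entry 473 0 2 7 1 6 4 3 5; entry 475 0 2 3 4 5 1 7 6;
      entry 479 0 2 7 1 5 4 3 6; entry 497 0 5 6 1 7 3 4 2]);
   ([:: 123128502409; 235647316695; 217397632761; 274519568664; 145050443739; 60728294754;
       184827740355; 258484932972; 223862087637; 20372278977; 38265405372; 9114390297]%num,
    [:: entry 320 6 5 2 4 3 0 7 1; entry 324 0 2 5 3 7 4 6 1; entry 326 0 2 5 3 6 4 7 1;
      entry 332 0 2 5 1 4 7 6 3; entry 334 0 3 5 4 7 1 2 6; entry 338 0 2 5 7 3 4 6 1;
      entry 340 0 1 2 5 4 7 6 3; entry 344 0 1 2 6 7 3 5 4; entry 346 0 2 1 3 4 7 6 5;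
      entry 348 0 2 5 7 4 6 1 3; entry 350 0 2 1 3 6 4 7 5; entry 352 0 1 2 3 6 7 5 4;
      entry 354 0 1 2 4 5 7 6 3; entry 356 0 1 2 3 4 7 6 5; entry 358 0 1 2 5 6 7 4 3;
      entry 360 0 1 2 4 7 6 5 3; entry 362 0 1 2 4 6 7 5 3; entry 364 0 1 2 3 7 6 5 4;
      entry 366 0 1 2 6 5 7 3 4; entry 368 0 1 7 2 6 5 4 3; entry 370 0 1 2 6 4 7 3 5;
      entry 372 0 1 3 2 4 5 6 7; entry 376 0 1 5 3 4 6 2 7; entry 380 0 1 2 7 4 3 5 6;
      entry 382 0 1 2 7 4 5 3 6]);
   ([:: 77929307578; 198479218890; 161028217332; 16195152744; 252455043816; 279952155612;
       160755943113; 88556850369; 237073021992; 120148594623; 144647079939; 25284368457]%num,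
    [:: entry 313 2 4 7 0 1 5 6 3; entry 323 1 4 7 2 5 6 0 3; entry 329 1 0 3 2 5 7 4 6;
      entry 331 0 4 7 2 6 5 1 3; entry 333 0 1 2 4 6 7 3 5; entry 337 0 1 2 7 4 5 3 6;
      entry 339 0 4 2 3 5 1 7 6; entry 341 0 1 2 3 4 5 6 7; entry 343 0 1 3 4 6 7 2 5;
      entry 345 0 1 7 2 4 5 3 6; entry 347 0 1 4 3 5 6 7 2; entry 349 0 1 2 6 4 5 3 7;
      entry 351 0 1 3 7 5 4 6 2; entry 353 0 1 2 3 5 4 6 7; entry 355 0 1 4 2 5 3 7 6;
      entry 357 0 1 2 4 3 5 7 6]);
   ([:: 184928713417; 160736456217; 102106822221; 87815310867; 143061968664; 127088269542;
       1202474565; 133143510240; 20657826819; 253025634222; 19463731380; 251830226583]%num,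
    [:: entry 467 1 6 5 0 3 7 4 2; entry 477 5 3 0 2 1 7 6 4; entry 485 6 0 3 2 4 7 5 1;
      entry 489 6 3 0 2 4 7 5 1]);
   ([:: 102647829151; 118566081426; 19338075117; 158509718451; 127074451914; 29440237320;
       128335562055; 189108499068; 105005839428; 64271962782; 14364377838; 223070942574]%num,
    [:: entry 483 6 7 3 5 2 4 1 0; entry 503 3 7 6 5 2 4 1 0]);
   ([:: 251115438439; 70209733395; 160430346207; 159301565541; 249231834468; 253148554800;
       256874133843; 258136839117; 238642879023; 11365239762; 91389664908; 80542009314]%num,
    [:: entry 499 5 2 0 6 7 1 3 4]);
   ([:: 29319599971; 153423296616; 277015392729; 115414400124; 146106712251; 116146253646;
       474990885; 276670903041; 82525353687; 62504508114; 280106607870; 147879835542]%num,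
    [:: entry 493 1 5 2 7 0 4 3 6]);
   ([:: 902386819; 114121817490; 28095159915; 25010144928; 252221898681; 124797404538;
       34606730061; 11479127787; 103761913194; 64822358511; 222444786978; 33433484751]%num,
    [:: entry 491 0 1 5 2 7 3 4 6])].

Lemma codes_checked : check fixed_code moving_codes.
Proof. vm_cast_no_check (erefl true). Qed.

Lemma Gamma_range beta : beta \in Gamma -> 0 < beta < 561.
Proof. by rewrite !inE; lia. Qed.

Definition values (fs : seq family) : seq nat :=
  flatten [seq [seq e.1 | e <- f.2] | f <- fs].

Lemma mem_values fs b : b \in values fs ->
  exists f e, [/\ f \in fs, e \in f.2 & b = e.1].
Proof. by case/flattenP=> _ /mapP[f f_in ->] /mapP[e e_in ->]; exists f, e. Qed.

Lemma Gamma_values beta : beta \in Gamma -> beta \in values moving_codes.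
Proof.
have covered : all (fun b => (b \in Gamma) ==> (b \in values moving_codes)) (iota 0 561).
  by vm_compute.
move=> betaG; have := allP covered beta; rewrite betaG; apply.
by rewrite mem_iota; case/andP: (Gamma_range betaG).
Qed.

Theorem proposition2p2 (beta : nat) :
  beta \in Gamma ->
  exists C : ternary_code 48,
    near_extremal_self_dual C /\ num_weight C 12 = 8 * beta.
Proof.
move=> betaG; have /andP[beta_pos _] := Gamma_range betaG.
have [f [e [f_in e_in beta_e]]] := mem_values (Gamma_values betaG).
by move: beta_pos; rewrite beta_e; exact: checked_code codes_checked f_in e_in.
Qed.
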